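(* Let $X$ be a compact Hausdorff space, let $\varphi_{0,\infty}=\{\varphi_j\}_{j=0}^\infty$ be a sequence of arbitrary multivalued maps $\varphi_j:X\multimap X$, $j\in\mathbb{N}\cup\{0\}$, and let $\psi_{0,\infty}=\{\psi_j\}_{j=0}^\infty$ be a sequence of (multivalued) selections $\psi_j\subset\varphi_j$, i.e. $\psi_j(x)\subset\varphi_j(x)$ for every $x\in X$ and $j\in\mathbb{N}\cup\{0\}$. Then the following inequalities hold: $$h_\rho^{\mathrm{span}}(\varphi_{0,\infty})\le h_{\mathrm{CMM}}^{\mathrm{span}}(\varphi_{0,\infty}),\qquad h_\rho^{\mathrm{span}}(\varphi_{0,\infty})\le h_\rho^{\mathrm{span}}(\psi_{0,\infty}),$$ $$h_{\mathrm{CMM}}^{\mathrm{span}}(\varphi_{0,\infty})\le h_{\mathrm{CMM}}^{\mathrm{sep}}(\varphi_{0,\infty}),\qquad h_{\mathrm{CMM}}^{\mathrm{span}}(\varphi_{0,\infty})\le h_{\mathrm{CMM}}^{\mathrm{span}}(\psi_{0,\infty}),$$ $$h_\rho^{\mathrm{span}}(\psi_{0,\infty})\le h_{\mathrm{CMM}}^{\mathrm{span}}(\psi_{0,\infty}),\qquad h_\rho^{\mathrm{span}}(\psi_{0,\infty})\le h_\rho^{\mathrm{sep}}(\psi_{0,\infty}),$$ $$\max\{h_{\mathrm{CMM}}^{\mathrm{sep}}(\varphi_{0,\infty}),\,h_{\mathrm{CMM}}^{\mathrm{span}}(\psi_{0,\infty}),\,h_\rho^{\mathrm{sep}}(\psi_{0,\infty})\}\le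 h_{\mathrm{CMM}}^{\mathrm{sep}}(\psi_{0,\infty})\le h_{\mathrm{KTRT}}(\psi_{0,\infty})\le h_{\mathrm{KTRT}}(\varphi_{0,\infty}).$$
   Context: Multivalued maps $\varphi:X\multimap X$ assign to each point a nonempty subset of $X$. Composition: $(\varphi_2\circ\varphi_1)(x)=\bigcup_{y\in\varphi_1(x)}\varphi_2(y)$. $\mathbb{N}=\{1,2,\dots\}$. Uniformities. A uniformity on a nonempty set $X$ is a family $\mathcal{U}$ of pseudometrics on $X$ such that: (U1) $p_0,p_1\in\mathcal{U}$ implies $\max\{p_0,p_1\}\in\mathcal{U}$; (U2) if $p$ is a pseudometric on $X$ such that for every $\varepsilon>0$ there are $q\in\mathcal{U}$, $\delta>0$ with $q(x,y)<\delta\Rightarrow p(x,y)<\varepsilon$ for all $x,y\in X$, then $p\in\mathcal{U}$; (U3) for $x\ne y$ there is $p\in\mathcal{U}$ with $p(x,y)>0$. The balls $B_p(x,r)=\{y: p(x,y)<r\}$, $p\in\mathcal{U}$, $x\in X$, $r>0$, form a base of a Hausdorff topology. A compact Hausdorff space $X$ carries a unique uniformity $\mathcal{U}$ inducing its topology; this is the $\mathcal{U}$ used below. For a function $q:Z\times Z\to[0,\infty)$ and $\varepsilon>0$, $S\subset Z$ is $(q,\varepsilon)$-separated if $q(x,y)>\varepsilon$ for all distinct $x,y\in S$; $R\subset Z$ is $(q,\varepsilon)$-spanning in $Z$ if for every $y\in Z$ there is $x\in R$ with $q(x,y)\le\varepsilon$. Orbits. $\mathrm{Orb}_1(\varphi_{0,\infty})=X$,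 $\mathrm{Orb}_n(\varphi_{0,\infty})=\{(x_0,\dots,x_{n-1})\in X^n: x_{i+1}\in\varphi_i(x_i),\ i=0,\dots,n-2\}$ for $n\ge2$, and $\mathrm{Orb}_n(\varphi_{0,\infty},x)$ is the set of those with $x_0=x$. $h_{\mathrm{KTRT}}$: for $p\in\mathcal{U}$ let $p_n(\bar x,\bar y)=\max_{0\le i\le n-1}p(\bar x_i,\bar y_i)$ on $X^n$. Let $s_{\mathrm{KTRT}}(\varphi_{0,\infty},p,\varepsilon,n)$ be the largest cardinality of a $(p_n,\varepsilon)$-separated subset of $\mathrm{Orb}_n(\varphi_{0,\infty})$. Then $h_{\mathrm{KTRT}}(\varphi_{0,\infty})=\sup_{p\in\mathcal{U},\varepsilon>0}\limsup_{n\to\infty}\frac1n\log s_{\mathrm{KTRT}}(\varphi_{0,\infty},p,\varepsilon,n)$. (The same value is obtained with the smallest cardinality of a subset of $\mathrm{Orb}_n(\varphi_{0,\infty})$ that is $(p_n,\varepsilon)$-spanning in $\mathrm{Orb}_n(\varphi_{0,\infty})$.) $h_{\mathrm{CMM}}$: for $x,y\in X$ let $p_n^{\mathrm{CMM}}(x,y)=\inf\{\max_{0\le i\le n-1}p(\bar x_i,\bar y_i):\bar x\in\mathrm{Orb}_n(\varphi_{0,\infty},x),\bar y\in\mathrm{Orb}_n(\varphi_{0,\infty},y)\}$. Let $s_{\mathrm{CMM}}(\varphi_{0,\infty},p,\varepsilon,n)$ be the largest cardinality of a $(p_n^{\mathrm{CMM}},\varepsilon)$-separated subset of $X$ and $r_{\mathrm{CMM}}(\varphi_{0,\infty},p,\varepsilon,n)$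 the smallest cardinality of a $(p_n^{\mathrm{CMM}},\varepsilon)$-spanning set in $X$. Then $h_{\mathrm{CMM}}^{\mathrm{sep}}(\varphi_{0,\infty})=\sup_{p\in\mathcal{U},\varepsilon>0}\limsup_{n}\frac1n\log s_{\mathrm{CMM}}$ and $h_{\mathrm{CMM}}^{\mathrm{span}}(\varphi_{0,\infty})=\sup_{p\in\mathcal{U},\varepsilon>0}\limsup_{n}\frac1n\log r_{\mathrm{CMM}}$. $h_\rho$: let $\varphi^{[0]}=\mathrm{id}_X$, $\varphi^{[k]}=\varphi_{k-1}\circ\dots\circ\varphi_0$ for $k>0$, and $p^\rho(A,B)=\inf\{p(a,b):a\in A,b\in B\}$ for $A,B\subset X$. $S\subset X$ is $(p,\varepsilon,n)_\rho$-separated if for all distinct $x,y\in S$ there is $0\le k<n$ with $p^\rho(\varphi^{[k]}(x),\varphi^{[k]}(y))>\varepsilon$; $R\subset X$ is $(p,\varepsilon,n)_\rho$-spanning if for every $x\in X$ there is $y\in R$ with $p^\rho(\varphi^{[k]}(x),\varphi^{[k]}(y))\le\varepsilon$ for all $0\le k<n$. With $s_\rho(\varphi_{0,\infty},p,\varepsilon,n)$ the maximal cardinality of a $(p,\varepsilon,n)_\rho$-separated set and $r_\rho(\varphi_{0,\infty},p,\varepsilon,n)$ the least cardinality of a $(p,\varepsilon,n)_\rho$-spanning set, $h_\rho^{\mathrm{sep}}(\varphi_{0,\infty})=\sup_{p\in\mathcal{U},\varepsilon>0}\limsup_n\frac1n\log s_\rho$ and $h_\rho^{\mathrm{span}}(\varphi_{0,\infty})=\sup_{p\in\mathcal{U},\varepsilon>0}\limsup_n\frac1n\log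 r_\rho$. All these notions are defined in the same way for $\psi_{0,\infty}$. *)

(* Defs.v *)
From HB Require Import structures.
From mathcomp Require Export all_boot all_order all_algebra.
From mathcomp Require Export all_classical all_reals all_analysis.

Set Implicit Arguments.
Unset Strict Implicit.
Unset Printing Implicit Defensive.
Import Order.TTheory GRing.Theory Num.Theory.
Local Open Scope classical_set_scope.
Local Open Scope ring_scope.

Record pseudometric (R : realType) (X : Type) (p : X -> X -> R) : Prop := {
  pseudometric_ge0 : forall x y, 0 <= p x y ;
  pseudometric_refl : forall x, p x x = 0 ;
  pseudometric_sym : forall x y, p x y = p y x ;
  pseudometric_triangle : forall x y z, p x z <= p x y + p y z }.

Record uniformity (R : realType) (X : Type) (U : set (X -> X -> R)) : Prop := {
  uniformity_pseudometric : forall p, U p -> pseudometric p ;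
  uniformity_max : forall p0 p1, U p0 -> U p1 ->
    U (fun x y => Num.max (p0 x y) (p1 x y)) ;
  uniformity_saturated : forall p, pseudometric p ->
    (forall eps, 0 < eps -> exists q delta,
       [/\ U q, 0 < delta & forall x y, q x y < delta -> p x y < eps]) ->
    U p ;
  uniformity_separating : forall x y, x <> y -> exists2 p, U p & 0 < p x y }.

Definition pball (R : realType) (X : Type) (p : X -> X -> R) (x : X) (r : R) :
    set X :=
  [set y | p x y < r].

Definition induces_topology (R : realType) (X : topologicalType)
    (U : set (X -> X -> R)) : Prop :=
  basis [set B : set X | exists p x r, [/\ U p, 0 < r & B = pball p x r]].

Definition multivalued (X : Type) (phi : X -> set X) : Prop :=
  forall x, phi x !=set0.

Definition mcomp (X : Type) (phi2 phi1 : X -> set X) : X -> set X :=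
  fun x => \bigcup_(y in phi1 x) phi2 y.

Fixpoint miter (X : Type) (phi : nat -> X -> set X) (k : nat) : X -> set X :=
  if k is k'.+1 then mcomp (phi k') (miter phi k') else fun x => [set x].

Definition orb (X : Type) (phi : nat -> X -> set X) (n : nat) :
    set {ffun 'I_n -> X} :=
  [set xs | forall i j : 'I_n, j = i.+1 :> nat -> phi i (xs i) (xs j)].

Definition orb_from (X : Type) (phi : nat -> X -> set X) (n : nat) (x : X) :
    set {ffun 'I_n -> X} :=
  [set xs | orb phi xs /\ forall i : 'I_n, i = 0%N :> nat -> xs i = x].

Definition qseparated (R : realType) (T : Type) (Z : set T) (q : T -> T -> R)
    (eps : R) : set (set T) :=
  [set S | S `<=` Z /\ forall x y, S x -> S y -> x <> y -> eps < q x y].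

Definition qspanning (R : realType) (T : Type) (Z : set T) (q : T -> T -> R)
    (eps : R) : set (set T) :=
  [set A | A `<=` Z /\ forall y, Z y -> exists2 x, A x & q x y <= eps].

(* Cardinalities live in the extended reals; infinite sets have cardinality
   +oo, so that both numbers below are defined without a finiteness proof. *)
Definition max_card (R : realType) (T : choiceType) (F : set (set T)) : \bar R :=
  ereal_sup [set counting S | S in F].

Definition min_card (R : realType) (T : choiceType) (F : set (set T)) : \bar R :=
  ereal_inf [set counting S | S in F].

(* limsup_n (1/n) log (c n); the term n = 0 does not affect the limsup. *)
Definition growth_rate (R : realType) (c : nat -> \bar R) : \bar R :=
  limn_esup (fun n => ((n%:R^-1 : R)%:E * lne (c n))%E).

Definition entropy (R : realType) (X : Type) (U : set (X -> X -> R))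
    (c : (X -> X -> R) -> R -> nat -> \bar R) : \bar R :=
  ereal_sup [set h | exists p eps,
    [/\ U p, 0 < eps & h = growth_rate (c p eps)]].

(* For a pseudometric p and n > 0 the neutral element 0 is harmless. *)
Definition pmax (R : realType) (X : Type) (p : X -> X -> R) (n : nat)
    (xs ys : {ffun 'I_n -> X}) : R :=
  \big[Num.max/0]_(i < n) p (xs i) (ys i).

Definition s_KTRT (R : realType) (X : choiceType) (phi : nat -> X -> set X)
    (p : X -> X -> R) (eps : R) (n : nat) : \bar R :=
  max_card R (qseparated (orb phi (n := n)) (pmax p (n := n)) eps).

Definition h_KTRT (R : realType) (X : choiceType) (U : set (X -> X -> R))
    (phi : nat -> X -> set X) : \bar R :=
  entropy U (s_KTRT phi).

(* The infimum is over a nonempty set bounded below by 0 as soon as p is a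
   pseudometric and the phi j are nonempty-valued. *)
Definition p_CMM (R : realType) (X : Type) (phi : nat -> X -> set X)
    (p : X -> X -> R) (n : nat) (x y : X) : R :=
  inf [set d | exists xs ys : {ffun 'I_n -> X},
    [/\ orb_from phi x xs, orb_from phi y ys & d = pmax p xs ys]].

Definition s_CMM (R : realType) (X : choiceType) (phi : nat -> X -> set X)
    (p : X -> X -> R) (eps : R) (n : nat) : \bar R :=
  max_card R (qseparated [set: X] (p_CMM phi p n) eps).

Definition r_CMM (R : realType) (X : choiceType) (phi : nat -> X -> set X)
    (p : X -> X -> R) (eps : R) (n : nat) : \bar R :=
  min_card R (qspanning [set: X] (p_CMM phi p n) eps).

Definition h_CMM_sep (R : realType) (X : choiceType) (U : set (X -> X -> R))
    (phi : nat -> X -> set X) : \bar R :=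
  entropy U (s_CMM phi).

Definition h_CMM_span (R : realType) (X : choiceType) (U : set (X -> X -> R))
    (phi : nat -> X -> set X) : \bar R :=
  entropy U (r_CMM phi).

(* Only meaningful for nonempty A and B. *)
Definition p_rho (R : realType) (X : Type) (p : X -> X -> R) (A B : set X) : R :=
  inf [set d | exists a b, [/\ A a, B b & d = p a b]].

Definition rho_separated (R : realType) (X : Type) (phi : nat -> X -> set X)
    (p : X -> X -> R) (eps : R) (n : nat) : set (set X) :=
  [set S | forall x y, S x -> S y -> x <> y ->
     exists2 k, (k < n)%N & eps < p_rho p (miter phi k x) (miter phi k y)].

Definition rho_spanning (R : realType) (X : Type) (phi : nat -> X -> set X)
    (p : X -> X -> R) (eps : R) (n : nat) : set (set X) :=
  [set A | forall x, exists2 y, A y &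
     forall k, (k < n)%N -> p_rho p (miter phi k x) (miter phi k y) <= eps].

Definition s_rho (R : realType) (X : choiceType) (phi : nat -> X -> set X)
    (p : X -> X -> R) (eps : R) (n : nat) : \bar R :=
  max_card R (rho_separated phi p eps n).

Definition r_rho (R : realType) (X : choiceType) (phi : nat -> X -> set X)
    (p : X -> X -> R) (eps : R) (n : nat) : \bar R :=
  min_card R (rho_spanning phi p eps n).

Definition h_rho_sep (R : realType) (X : choiceType) (U : set (X -> X -> R))
    (phi : nat -> X -> set X) : \bar R :=
  entropy U (s_rho phi).

Definition h_rho_span (R : realType) (X : choiceType) (U : set (X -> X -> R))
    (phi : nat -> X -> set X) : \bar R :=
  entropy U (r_rho phi).

(* Main.v *)
Require Import Defs.

Set Implicit Arguments.
Unset Strict Implicit.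
Unset Printing Implicit Defensive.
Import Order.TTheory GRing.Theory Num.Theory.
Local Open Scope classical_set_scope.
Local Open Scope ereal_scope.

(** All the inequalities hold already before passing to the limit: for each
    pseudometric p of the uniformity, each eps > 0 and each length n, the
    corresponding cardinalities are ordered, and [entropy] is monotone in these
    cardinalities ([le_entropy]).  These cardinalities may be infinite, so no
    finiteness argument enters.

    Three facts give the ordering of the cardinalities.

    - The k-th entry of an orbit issuing from x lies in phi^[k](x)
      ([orb_from_miter]), so the distance [p_rho] between phi^[k](x) and
      phi^[k](y) is at most [p_CMM] ([p_rho_le_p_CMM]), which in turn is at most
      the distance [pmax] of any two orbits issuing from x and y
      ([p_CMM_le_pmax]).  Hence rho-separated sets are CMM-separated,
      CMM-spanning sets are rho-spanning, and choosing one orbit per point turns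
      a CMM-separated set into an equinumerous separated set of orbits.

    - Replacing the maps by selections shrinks the orbit sets and the iterated
      images, so it enlarges the infima [p_rho] and [p_CMM]
      ([p_rho_selection], [p_CMM_selection]).

    - By Zorn's lemma there is a maximal separated set, and a maximal separated
      set is spanning ([exists_maximal_pairwise]). *)

(** * Monotonicity of cardinalities and growth rates *)

Lemma le_lne_homo (R : realType) (x y : \bar R) : x <= y -> lne x <= lne y.
Proof.
move=> xy; have [x0|x0] := leP x 0; first by rewrite le0_lneNy// leNye.
by rewrite lee_lne// in_itv/= leey andbT ltW// (lt_le_trans x0 xy).
Qed.

Lemma le_growth_rate (R : realType) (c d : nat -> \bar R) :
  (forall n, c n <= d n) -> growth_rate c <= growth_rate d.
Proof.
move=> cd; apply: le_ereal_inf_tmp => _ [V Voo <-].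
apply: ge_ereal_inf; exists (ereal_sup
  [set ((n%:R^-1 : R)%:E * lne (c n))%E | n in V]); first by exists V.
apply: ge_ereal_sup => _ [n Vn <-].
apply: le_ereal_sup_tmp; exists ((n%:R^-1 : R)%:E * lne (d n)).
  by exists n.
by apply: lee_wpmul2l; [rewrite lee_fin invr_ge0|apply: le_lne_homo].
Qed.

Lemma le_entropy (R : realType) (X : Type) (U : set (X -> X -> R))
    (c d : (X -> X -> R) -> R -> nat -> \bar R) :
  (forall p eps n, U p -> (0 < eps)%R -> c p eps n <= d p eps n) ->
  entropy U c <= entropy U d.
Proof.
move=> cd; apply: ge_ereal_sup => _ [p [eps [Up eps0 ->]]].
apply: le_ereal_sup_tmp; exists (growth_rate (d p eps)).
  by exists p, eps.
by apply: le_growth_rate => n; exact: cd.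
Qed.

Lemma le_max_card (R : realType) (T : choiceType) (F G : set (set T)) :
  F `<=` G -> max_card R F <= max_card R G.
Proof. by move=> FG; apply: ereal_sup_le; exact: image_subset. Qed.

Lemma le_min_card (R : realType) (T : choiceType) (F G : set (set T)) :
  G `<=` F -> min_card R F <= min_card R G.
Proof. by move=> GF; apply: ereal_inf_le_tmp; exact: image_subset. Qed.

Lemma min_card_le_max_card (R : realType) (T : choiceType)
    (F G : set (set T)) (S : set T) :
  F S -> G S -> min_card R F <= max_card R G.
Proof.
move=> FS GS; apply: (@le_trans _ _ (counting S)).
  by apply: ge_ereal_inf; exists (counting S) => //; exists S.
by apply: le_ereal_sup_tmp; exists (counting S) => //; exists S.
Qed.

Lemma counting_image (R : realType) (T T' : choiceType) (f : T -> T')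
    (S : set T) :
  {in S &, injective f} -> counting (f @` S) = counting S :> \bar R.
Proof.
move=> /inj_card_eq fS; rewrite /counting (eq_finite_set fS).
case: ifPn => // /asboolP finS; congr (_%:R%:E).
by apply/fcard_eq => //; rewrite (eq_finite_set fS).
Qed.

(** * Maximal separated sets *)

(** The relation [r x y] is to be read: x and y are separated.  A maximal set of
    pairwise separated points leaves no point separated from all its members. *)
Lemma exists_maximal_pairwise (T : Type) (r : T -> T -> Prop) :
  (forall x y, r x y -> r y x) -> (forall x, ~ r x x) ->
  exists2 S : set T, (forall x y, S x -> S y -> x <> y -> r x y) &
    forall y, exists2 x, S x & ~ r x y.
Proof.
move=> rsym rirr.
pose P := [set S : set T | forall x y, S x -> S y -> x <> y -> r x y].
(* Two points of a chain's union already lie in the larger of two members. *)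
have [F FP Ftot|S [PS maxS]] := @Zorn_bigcup T P.
  move=> x y [A FA Ax] [B FB By].
  by have [AB|BA] := Ftot _ _ FA FB;
    [apply: (FP _ FB) => //; exact: AB|apply: (FP _ FA) => //; exact: BA].
exists S => // y; apply: contrapT => Sy.
have ry x : S x -> r x y.
  by move=> Sx; apply: contrapT => nrxy; apply: Sy; exists x.
apply: (maxS (y |` S)).
  split; first by move=> x Sx; right.
  by move=> /(_ y (or_introl erefl)) /ry /rirr.
move=> x z [->|Sx] [->|Sz] xz //; last exact: PS.
- exact/rsym/ry.
- exact: ry.
Qed.

(** * Infimum distances *)

Lemma le_inf_subset (R : realType) (A B : set R) :
  B !=set0 -> has_lbound A -> B `<=` A -> (inf A <= inf B)%R.
Proof. by move=> B0 A0 BA; apply: lb_le_inf => // d /BA; exact: ge_inf. Qed.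

Section distances.
Context (R : realType) (X : Type) (p : X -> X -> R) (p_pseudo : pseudometric p).
Implicit Types (phi psi : nat -> X -> set X).

Lemma pmax_ge0 n (xs ys : {ffun 'I_n -> X}) : (0 <= pmax p xs ys)%R.
Proof. exact: bigmax_ge_id. Qed.

Lemma pmax_refl n (xs : {ffun 'I_n -> X}) : pmax p xs xs = 0%R.
Proof.
apply/eqP; rewrite eq_le pmax_ge0 andbT; apply: bigmax_le => // i _.
by rewrite (pseudometric_refl p_pseudo).
Qed.

Lemma pmax_sym n (xs ys : {ffun 'I_n -> X}) : pmax p xs ys = pmax p ys xs.
Proof. by apply: eq_bigr => i _; exact: pseudometric_sym. Qed.

Lemma miter_nonempty phi k x :
  (forall j, multivalued (phi j)) -> miter phi k x !=set0.
Proof.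
move=> phi0; elim: k => [|k [y ky]] /=; first by exists x.
by have [z yz] := phi0 k y; exists z, y.
Qed.

Lemma miter_selection phi psi k x :
  (forall j x, psi j x `<=` phi j x) -> miter psi k x `<=` miter phi k x.
Proof.
move=> sel; elim: k => [|k IH] //= z [y ky yz].
by exists y; [exact: IH|exact: sel].
Qed.

Lemma orb_selection phi psi n :
  (forall j x, psi j x `<=` phi j x) ->
  orb psi (n := n) `<=` orb phi (n := n).
Proof. by move=> sel xs oxs i j ij; apply: sel; exact: oxs. Qed.

Lemma orb_from_selection phi psi n x :
  (forall j x, psi j x `<=` phi j x) ->
  orb_from psi (n := n) x `<=` orb_from phi (n := n) x.
Proof. by move=> sel xs [oxs xs0]; split=> //; exact: orb_selection oxs. Qed.

Lemma orb_from_nonempty phi n x :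
  (forall j, multivalued (phi j)) -> orb_from phi (n := n) x !=set0.
Proof.
move=> phi0.
have /choice[f fP] (jy : nat * X) : exists z, phi jy.1 jy.2 z by exact: phi0.
(* The orbit is built by dependent choice: g k.+1 is a point of phi k (g k). *)
pose g := fix g k := if k is j.+1 then f (j, g j) else x.
exists [ffun i : 'I_n => g i]; split => [i j ij|i i0]; rewrite !ffunE.
  by rewrite ij; exact: (fP (_, _)).
by rewrite i0.
Qed.

Lemma orb_from_miter phi n x (xs : {ffun 'I_n -> X}) (i : 'I_n) :
  orb_from phi x xs -> miter phi i x (xs i).
Proof.
case: i => k kn [oxs xs0] /=.
elim: k kn => [|k IH] kn /=; first exact: xs0.
by exists (xs (Ordinal (ltnW kn))); [exact: IH|exact: (oxs (Ordinal _))].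
Qed.

Lemma p_CMM_lbound phi n x y : has_lbound [set d | exists xs ys :
  {ffun 'I_n -> X},
  [/\ orb_from phi x xs, orb_from phi y ys & d = pmax p xs ys]].
Proof. by exists 0%R => _ [xs [ys [_ _ ->]]]; exact: pmax_ge0. Qed.

Lemma p_CMM_nonempty phi n x y : (forall j, multivalued (phi j)) ->
  [set d | exists xs ys : {ffun 'I_n -> X},
    [/\ orb_from phi x xs, orb_from phi y ys & d = pmax p xs ys]] !=set0.
Proof.
move=> phi0; have [xs oxs] := orb_from_nonempty n x phi0.
by have [ys oys] := orb_from_nonempty n y phi0; exists (pmax p xs ys), xs, ys.
Qed.

Lemma p_CMM_le_pmax phi n x y (xs ys : {ffun 'I_n -> X}) :
  orb_from phi x xs -> orb_from phi y ys ->
  (p_CMM phi p n x y <= pmax p xs ys)%R.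
Proof.
by move=> oxs oys; apply: ge_inf; [exact: p_CMM_lbound|exists xs, ys].
Qed.

Lemma p_CMM_sym phi n x y : p_CMM phi p n x y = p_CMM phi p n y x.
Proof.
by congr inf; apply/seteqP; split=> _ [xs [ys [oxs oys ->]]];
  exists ys, xs; rewrite pmax_sym.
Qed.

Lemma p_CMM_refl_le0 phi n x : (forall j, multivalued (phi j)) ->
  (p_CMM phi p n x x <= 0)%R.
Proof.
move=> phi0; have [xs oxs] := orb_from_nonempty n x phi0.
by rewrite -(pmax_refl xs); exact: p_CMM_le_pmax.
Qed.

Lemma p_rho_lbound (A B : set X) :
  has_lbound [set d | exists a b, [/\ A a, B b & d = p a b]].
Proof. by exists 0%R => _ [a [b [_ _ ->]]]; exact: pseudometric_ge0. Qed.

Lemma p_rho_le (A B : set X) a b : A a -> B b -> (p_rho p A B <= p a b)%R.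
Proof. by move=> Aa Bb; apply: ge_inf; [exact: p_rho_lbound|exists a, b]. Qed.

Lemma p_rho_sym (A B : set X) : p_rho p A B = p_rho p B A.
Proof.
by congr inf; apply/seteqP; split=> _ [a [b [Aa Bb ->]]]; exists b, a;
  rewrite (pseudometric_sym p_pseudo).
Qed.

Lemma p_rho_refl_le0 (A : set X) : A !=set0 -> (p_rho p A A <= 0)%R.
Proof.
by move=> [a Aa]; rewrite -(pseudometric_refl p_pseudo a); exact: p_rho_le.
Qed.

Lemma p_rho_selection phi psi k x y :
  (forall j, multivalued (psi j)) -> (forall j x, psi j x `<=` phi j x) ->
  (p_rho p (miter phi k x) (miter phi k y)
     <= p_rho p (miter psi k x) (miter psi k y))%R.
Proof.
move=> psi0 sel; apply: le_inf_subset; last 2 first.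
- exact: p_rho_lbound.
- move=> _ [a [b [ka kb ->]]]; exists a, b.
  by split=> //; exact: miter_selection sel _ _.
have [a ka] := miter_nonempty k x psi0.
by have [b kb] := miter_nonempty k y psi0; exists (p a b), a, b.
Qed.

Lemma p_CMM_selection phi psi n x y :
  (forall j, multivalued (psi j)) -> (forall j x, psi j x `<=` phi j x) ->
  (p_CMM phi p n x y <= p_CMM psi p n x y)%R.
Proof.
move=> psi0 sel; apply: le_inf_subset.
- exact: p_CMM_nonempty.
- exact: p_CMM_lbound.
- move=> _ [xs [ys [oxs oys ->]]]; exists xs, ys.
  by split=> //; exact: orb_from_selection sel _ _.
Qed.

Lemma p_rho_le_p_CMM phi n k x y :
  (forall j, multivalued (phi j)) -> (k < n)%N ->
  (p_rho p (miter phi k x) (miter phi k y) <= p_CMM phi p n x y)%R.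
Proof.
move=> phi0 kn; apply: lb_le_inf; first exact: p_CMM_nonempty.
move=> _ [xs [ys [oxs oys ->]]]; pose i := Ordinal kn.
apply: (@le_trans _ _ (p (xs i) (ys i))).
  by apply: p_rho_le; exact: (@orb_from_miter _ _ _ _ i).
exact: (le_bigmax _ (fun i => p (xs i) (ys i))).
Qed.

End distances.

(** * Comparison of the cardinalities *)

Section cardinalities.
Context (R : realType) (X : choiceType) (p : X -> X -> R).
Context (p_pseudo : pseudometric p) (eps : R) (n : nat).
Implicit Types (phi psi : nat -> X -> set X).

Lemma r_rho_le_r_CMM phi : (forall j, multivalued (phi j)) ->
  r_rho phi p eps n <= r_CMM phi p eps n.
Proof.
move=> phi0; apply: le_min_card => A [_ spanA] x.
have [y Ay xy] := spanA x I; exists y => // k kn.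
rewrite (p_rho_sym p_pseudo); apply: le_trans xy.
exact: p_rho_le_p_CMM.
Qed.

Lemma r_rho_selection phi psi :
  (forall j, multivalued (psi j)) -> (forall j x, psi j x `<=` phi j x) ->
  r_rho phi p eps n <= r_rho psi p eps n.
Proof.
move=> psi0 sel; apply: le_min_card => A spanA x.
have [y Ay xy] := spanA x; exists y => // k kn.
by apply: le_trans (xy k kn); exact: p_rho_selection.
Qed.

Lemma r_CMM_selection phi psi :
  (forall j, multivalued (psi j)) -> (forall j x, psi j x `<=` phi j x) ->
  r_CMM phi p eps n <= r_CMM psi p eps n.
Proof.
move=> psi0 sel; apply: le_min_card => A [_ spanA]; split=> // y _.
have [x Ax xy] := spanA y I; exists x => //.
by apply: le_trans xy; exact: p_CMM_selection.
Qed.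

Lemma s_CMM_selection phi psi :
  (forall j, multivalued (psi j)) -> (forall j x, psi j x `<=` phi j x) ->
  s_CMM phi p eps n <= s_CMM psi p eps n.
Proof.
move=> psi0 sel; apply: le_max_card => S [_ sepS]; split=> // x y Sx Sy xy.
by apply: lt_le_trans (sepS x y Sx Sy xy) _; exact: p_CMM_selection.
Qed.

Lemma s_KTRT_selection phi psi :
  (forall j x, psi j x `<=` phi j x) ->
  s_KTRT psi p eps n <= s_KTRT phi p eps n.
Proof.
move=> sel; apply: le_max_card => S [orbS sepS]; split=> //.
by move=> xs /orbS; exact: orb_selection.
Qed.

Lemma s_rho_le_s_CMM phi : (forall j, multivalued (phi j)) ->
  s_rho phi p eps n <= s_CMM phi p eps n.
Proof.
move=> phi0; apply: le_max_card => S sepS; split=> // x y Sx Sy xy.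
have [k kn lt_eps] := sepS x y Sx Sy xy.
by apply: lt_le_trans lt_eps _; exact: p_rho_le_p_CMM.
Qed.

Context (eps_gt0 : (0 < eps)%R).

Lemma r_CMM_le_s_CMM phi : (forall j, multivalued (phi j)) ->
  r_CMM phi p eps n <= s_CMM phi p eps n.
Proof.
move=> phi0; have [||S sepS spanS] :=
  @exists_maximal_pairwise X (fun x y => eps < p_CMM phi p n x y)%R.
- by move=> x y; rewrite (p_CMM_sym p_pseudo).
- by move=> x; apply/negP; rewrite -leNgt (le_trans _ (ltW eps_gt0))//;
    exact: p_CMM_refl_le0.
apply: (@min_card_le_max_card _ _ _ _ S); split=> // y _.
by have [x Sx /negP xy] := spanS y; exists x; rewrite // leNgt.
Qed.

Lemma r_rho_le_s_rho phi : (forall j, multivalued (phi j)) ->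
  r_rho phi p eps n <= s_rho phi p eps n.
Proof.
move=> phi0; have [||S sepS spanS] := @exists_maximal_pairwise X (fun x y =>
  exists2 k, (k < n)%N & (eps < p_rho p (miter phi k x) (miter phi k y))%R).
- by move=> x y [k kn xy]; exists k => //; rewrite (p_rho_sym p_pseudo).
- move=> x [k kn]; apply/negP; rewrite -leNgt (le_trans _ (ltW eps_gt0))//.
  by apply: p_rho_refl_le0 => //; exact: miter_nonempty.
apply: (@min_card_le_max_card _ _ _ _ S) => // y.
have [x Sx xy] := spanS y; exists x => // k kn; rewrite (p_rho_sym p_pseudo).
by rewrite leNgt; apply/negP => xyk; apply: xy; exists k.
Qed.

(** Choosing one orbit per point of a CMM-separated set is injective on that set,
    because the chosen orbits are more than eps > 0 apart. *)
Lemma s_CMM_le_s_KTRT phi : (forall j, multivalued (phi j)) ->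
  s_CMM phi p eps n <= s_KTRT phi p eps n.
Proof.
move=> phi0; apply: ge_ereal_sup => _ [S [_ sepS] <-].
have /choice[f fP] x : exists xs : {ffun 'I_n -> X}, orb_from phi x xs.
  by have [xs oxs] := @orb_from_nonempty X phi n x phi0; exists xs.
have sepf x y : S x -> S y -> x <> y -> (eps < pmax p (f x) (f y))%R.
  move=> Sx Sy xy; apply: lt_le_trans (sepS x y Sx Sy xy) _.
  exact: p_CMM_le_pmax.
apply: le_ereal_sup_tmp; exists (counting (f @` S)).
  exists (f @` S) => //; split=> [_ [x _ <-]|_ _ [x Sx <-] [y Sy <-] fxy].
    by have [] := fP x.
  by apply: sepf => // xy; apply: fxy; rewrite xy.
rewrite counting_image// => x y /set_mem Sx /set_mem Sy fxy.
apply: contrapT => /(sepf x y Sx Sy); rewrite fxy (pmax_refl p_pseudo).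
by rewrite ltNge (ltW eps_gt0).
Qed.

End cardinalities.

Theorem theorem3p23 (R : realType) (X : topologicalType)
    (X_nonempty : [set: X] !=set0)
    (X_compact : compact [set: X]) (X_hausdorff : hausdorff_space X)
    (U : set (X -> X -> R))
    (U_uniformity : uniformity U) (U_topology : induces_topology U)
    (phi psi : nat -> X -> set X)
    (phi_multivalued : forall j, multivalued (phi j))
    (psi_multivalued : forall j, multivalued (psi j))
    (psi_selection : forall j x, psi j x `<=` phi j x) :
  (h_rho_span U phi <= h_CMM_span U phi) /\
  (h_rho_span U phi <= h_rho_span U psi) /\
  (h_CMM_span U phi <= h_CMM_sep U phi) /\
  (h_CMM_span U phi <= h_CMM_span U psi) /\
  (h_rho_span U psi <= h_CMM_span U psi) /\
  (h_rho_span U psi <= h_rho_sep U psi) /\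
  (maxe (maxe (h_CMM_sep U phi) (h_CMM_span U psi)) (h_rho_sep U psi)
     <= h_CMM_sep U psi) /\
  (h_CMM_sep U psi <= h_KTRT U psi) /\
  (h_KTRT U psi <= h_KTRT U phi).
Proof.
have pseudo := uniformity_pseudometric U_uniformity.
do 6![split; first by apply: le_entropy => p eps n /pseudo pp eps0;
  by [exact: r_rho_le_r_CMM|exact: r_rho_selection|exact: r_CMM_le_s_CMM
     |exact: r_CMM_selection|exact: r_rho_le_s_rho]].
split.
  rewrite !ge_max -!andbA; apply/and3P; split;
    apply: le_entropy => p eps n /pseudo pp eps0.
  - exact: s_CMM_selection.
  - exact: r_CMM_le_s_CMM.
  - exact: s_rho_le_s_CMM.
split; apply: le_entropy => p eps n /pseudo pp eps0.
- exact: s_CMM_le_s_KTRT.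
- exact: s_KTRT_selection.
Qed.
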